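(* The sign of the pressure is preserved under affine motion. That is, let $\kappa=c_0^2\ge0$, let $A\in C^0(\mathbb{R},\mathrm{SL}(2,\mathbb{R}))\cap C^2(\mathbb{R},\mathbb{M}^2)$ and $\lambda\in C^0(\mathbb{R},\mathbb{R})$ satisfy $\ddot A(t)+\kappa A(t)=\lambda(t)\,\mathrm{cof}\,A(t)$ for all $t\in\mathbb{R}$, and let $p(t,x)=\tfrac12\lambda(t)\left[1-|A(t)^{-1}x|^2\right]$ be the pressure of the associated affine fluid motion in $\Omega(t)=A(t)\mathcal{B}$. Then the sign (positive, negative, or zero) of $p(t,\cdot)$ in the interior of $\Omega(t)$ (equivalently, the sign of $\lambda(t)$) is the same for all $t\in\mathbb{R}$.
   Context: $\mathbb{M}^2$ is the space of real $2\times2$ matrices, $\mathrm{SL}(2,\mathbb{R})=\{A\in\mathbb{M}^2:\det A=1\}$, $Z=\begin{bmatrix}0&-1\\1&0\end{bmatrix}$, $\mathrm{cof}\,A=ZAZ^\top$ is the cofactor matrix, and $\mathcal{B}\subset\mathbb{R}^2$ is the closed unit disk. The associated affine motion is $x(t,y)=A(t)y$, $y\in\mathcal{B}$, with velocity $u(t,x)=\dot A(t)A(t)^{-1}x$, magnetic field $b(t,x)=c_0A(t)ZA(t)^{-1}x$, and pressure $p(t,x)=\tfrac12\lambda(t)\left[1-|A(t)^{-1}x|^2\right]$; these solve the 2d incompressible free-boundary MHD equations $D_tu=-\nabla p+b\cdot\nabla b$, $D_tb=b\cdot\nabla u$, $\nabla\cdot u=\nabla\cdot b=0$ in $\Omega(t)$,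 with $p=0$ and $b\cdot n=0$ on $\partial\Omega(t)$ (the incompressible Euler equations if $c_0=0$), where $D_t=\partial_t+u\cdot\nabla$. *)

(* Defs.v *)
From mathcomp Require Export all_boot all_order all_algebra.
From mathcomp Require Export all_classical all_reals all_analysis.
Export Order.TTheory GRing.Theory Num.Theory.
Export numFieldNormedType.Exports.

Set Implicit Arguments.
Unset Strict Implicit.
Unset Printing Implicit Defensive.

Local Open Scope ring_scope.
Local Open Scope classical_set_scope.

Definition SL2 (R : realType) : set 'M[R]_2 := [set A | \det A = 1].

(* [0 -1; 1 0] *)
Definition Zmx (R : realType) : 'M[R]_2 := delta_mx 1 0 - delta_mx 0 1.

Definition cof (R : realType) (A : 'M[R]_2) : 'M[R]_2 :=
  Zmx R *m A *m (Zmx R)^T.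

(* The library norm on matrices is the sup norm, so the Euclidean norm on the
   plane is introduced separately; both induce the same topology. *)
Definition enorm (R : realType) (v : 'cV[R]_2) : R :=
  Num.sqrt (\sum_(i < 2) v i 0 ^+ 2).

Definition unit_disk (R : realType) : set 'cV[R]_2 := [set y | enorm y <= 1].

Definition C2 (R : realType) (V : normedModType R) (f : R -> V) : Prop :=
  [/\ forall t, derivable f t 1, forall t, derivable f^`() t 1
    & continuous f^`(2)].

Definition fluid_domain (R : realType) (A : R -> 'M[R]_2) (t : R) :
    set 'cV[R]_2 :=
  (fun y => A t *m y) @` @unit_disk R.

Definition pressure (R : realType) (A : R -> 'M[R]_2) (lambda : R -> R)
    (t : R) (x : 'cV[R]_2) : R :=
  2^-1 * lambda t * (1 - enorm (invmx (A t) *m x) ^+ 2).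

(* [sigma] is one of -1, 0, 1 as soon as [D] is nonempty. *)
Definition has_sign_on (R : realType) (T : Type) (D : set T) (f : T -> R)
    (sigma : R) : Prop :=
  forall x, D x -> Num.sg (f x) = sigma.

(* Main.v *)
Require Import Defs.
From mathcomp Require Import ring lra.

(** Write [<M, N>] for the entrywise inner product of 2x2 matrices and [|M|^2]
    for [<M, M>].  The map [(M, N) |-> <cof M, N>] is symmetric, equals
    [2 det M] on the diagonal, and [cof] is an isometry.

    The theorem follows from a conservation law: along an affine motion,
    [lambda |A|^4] is constant.  Indeed, differentiating [<cof A, A> = 2] gives
    [<cof A, A'> = 0]; differentiating once more and inserting the equation of
    motion gives [lambda |A|^2 = 2 kappa - <cof A', A'>].  The derivative of the
    right-hand side is
      [- 2 <cof A', A''> = - 2 lambda <A', A> = - lambda (|A|^2)'],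
    again by the equation of motion and [<cof A, A'> = 0].  Hence
    [(lambda |A|^2) |A|^2] has derivative zero ([lambda_norm_conserved]).  As
    [|A|^2 > 0], the sign of [lambda] does not depend on time
    ([sg_lambda_const]).

    The interior of [Omega(t)] is the set where [|A(t)^-1 x| < 1]
    ([interior_fluid_domainE]).  It contains the origin, and on it the factor
    [1 - |A(t)^-1 x|^2] of the pressure is positive, so the pressure has the
    sign of [lambda(t)] there. *)

Local Open Scope ring_scope.
Local Open Scope classical_set_scope.

(** * The inner product and the cofactor form on 2x2 matrices *)

Lemma sum_ord2 {V : nmodType} (F : 'I_2 -> V) : \sum_(i < 2) F i = F 0 + F 1.
Proof.
rewrite !big_ord_recl big_ord0 addr0; congr (F _ + F _); exact: val_inj.
Qed.

Lemma det2E {R : comNzRingType} (M : 'M[R]_2) :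
  \det M = M 0 0 * M 1 1 - M 0 1 * M 1 0.
Proof.
rewrite (expand_det_row _ 0) sum_ord2 /cofactor !det_mx11 !mxE /=.
rewrite expr0 expr1 mul1r mulN1r mulrN.
by congr (_ * M _ _ - _ * M _ _); apply: val_inj.
Qed.

Lemma cofE {R : realType} (M : 'M[R]_2) :
  [/\ cof M 0 0 = M 1 1, cof M 0 1 = - M 1 0,
      cof M 1 0 = - M 0 1 & cof M 1 1 = M 0 0].
Proof. by split; do 2!rewrite !mxE ?sum_ord2/=; rewrite ?mxE/=; ring. Qed.

(** The entrywise (Frobenius) inner product [tr (M^T N)]. *)
Definition mxdot {R : realType} (M N : 'M[R]_2) : R :=
  \sum_(i < 2) \sum_(j < 2) M i j * N i j.

Lemma mxdotE {R : realType} (M N : 'M[R]_2) :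
  mxdot M N = M 0 0 * N 0 0 + M 0 1 * N 0 1 + M 1 0 * N 1 0 + M 1 1 * N 1 1.
Proof. by rewrite /mxdot !sum_ord2 addrA. Qed.

Lemma mxdotC {R : realType} (M N : 'M[R]_2) : mxdot M N = mxdot N M.
Proof. by rewrite !mxdotE; ring. Qed.

Lemma mxdotBr {R : realType} (M N P : 'M[R]_2) :
  mxdot M (N - P) = mxdot M N - mxdot M P.
Proof. by rewrite !mxdotE !mxE; ring. Qed.

Lemma mxdotZr {R : realType} (a : R) (M N : 'M[R]_2) :
  mxdot M (a *: N) = a * mxdot M N.
Proof. by rewrite !mxdotE !mxE; ring. Qed.

Lemma mxdot_cofE {R : realType} (M N : 'M[R]_2) :
  mxdot (cof M) N =
  M 1 1 * N 0 0 - M 1 0 * N 0 1 - M 0 1 * N 1 0 + M 0 0 * N 1 1.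
Proof. by rewrite mxdotE; have [-> -> -> ->] := cofE M; ring. Qed.

Lemma mxdot_cof_cof {R : realType} (M N : 'M[R]_2) :
  mxdot (cof M) (cof N) = mxdot M N.
Proof.
by rewrite mxdot_cofE mxdotE; have [-> -> -> ->] := cofE N; ring.
Qed.

(** Up to a factor 2, [(M, N) |-> <cof M, N>] is the polar form of the
    quadratic form [det], hence symmetric. *)
Lemma mxdot_cofC {R : realType} (M N : 'M[R]_2) :
  mxdot (cof M) N = mxdot (cof N) M.
Proof. by rewrite !mxdot_cofE; ring. Qed.

Lemma mxdot_cof_det {R : realType} (M : 'M[R]_2) :
  mxdot (cof M) M = 2 * \det M.
Proof. by rewrite mxdot_cofE det2E; ring. Qed.

Lemma mxdot_gt0 {R : realType} (M : 'M[R]_2) : M != 0 -> 0 < mxdot M M.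
Proof.
move=> M0; have sq_ge0 : 0 <= mxdot M M.
  by apply: sumr_ge0 => i _; apply: sumr_ge0 => j _; rewrite -expr2 sqr_ge0.
rewrite lt_neqAle sq_ge0 andbT eq_sym; apply: contra M0.
rewrite /mxdot psumr_eq0 => [/allP M0|i _]; last first.
  by apply: sumr_ge0 => j _; rewrite -expr2 sqr_ge0.
apply/eqP/matrixP => i j; rewrite mxE; apply/eqP; rewrite -(sqrf_eq0 (M i j)).
have /= := M0 i (mem_index_enum _).
rewrite psumr_eq0 => [/allP/(_ j (mem_index_enum _))//|k _].
by rewrite -expr2 sqr_ge0.
Qed.

(** * Product rules *)

Lemma is_derive_coord {R : realType} {m n} {f : R -> 'M[R]_(m, n)} {t : R} {df} i j :
  is_derive t 1 f df -> is_derive t 1 (fun s => f s i j) (df i j).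
Proof.
move=> [fd <-]; have /derivable_mxP fdij := fd.
by rewrite derive_mx// mxE; apply: DeriveDef.
Qed.

Lemma is_derive_mxdot {R : realType} {f g : R -> 'M[R]_2} {t : R} {df dg} :
  is_derive t 1 f df -> is_derive t 1 g dg ->
  is_derive t 1 (fun s => mxdot (f s) (g s)) (mxdot df (g t) + mxdot (f t) dg).
Proof.
move=> fd gd.
pose F i j : R -> R := fun s => f s i j.
pose G i j : R -> R := fun s => g s i j.
have Fd i j : is_derive t 1 (F i j) (df i j) by exact: is_derive_coord.
have Gd i j : is_derive t 1 (G i j) (dg i j) by exact: is_derive_coord.
have -> : (fun s => mxdot (f s) (g s)) =
    F 0 0 * G 0 0 + F 0 1 * G 0 1 + F 1 0 * G 1 0 + F 1 1 * G 1 1.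
  by apply/funext => s; rewrite mxdotE.
have FG i j := is_deriveM (Fd i j) (Gd i j).
apply: is_derive_eq
  (is_deriveD (is_deriveD (is_deriveD (FG 0 0) (FG 0 1)) (FG 1 0)) (FG 1 1)) _.
by rewrite !mxdotE /GRing.scale/= /F /G; ring.
Qed.

Lemma is_derive_mxdot_cof {R : realType} {f g : R -> 'M[R]_2} {t : R} {df dg} :
  is_derive t 1 f df -> is_derive t 1 g dg ->
  is_derive t 1 (fun s => mxdot (cof (f s)) (g s))
    (mxdot (cof df) (g t) + mxdot (cof (f t)) dg).
Proof.
move=> fd gd.
pose F i j : R -> R := fun s => f s i j.
pose G i j : R -> R := fun s => g s i j.
have Fd i j : is_derive t 1 (F i j) (df i j) by exact: is_derive_coord.
have Gd i j : is_derive t 1 (G i j) (dg i j) by exact: is_derive_coord.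
have -> : (fun s => mxdot (cof (f s)) (g s)) =
    F 1 1 * G 0 0 - F 1 0 * G 0 1 - F 0 1 * G 1 0 + F 0 0 * G 1 1.
  by apply/funext => s; rewrite mxdot_cofE.
have FG i j k l := is_deriveM (Fd i j) (Gd k l).
apply: is_derive_eq (is_deriveD (is_deriveB (is_deriveB
  (FG 1 1 0 0) (FG 1 0 0 1)) (FG 0 1 1 0)) (FG 0 0 1 1)) _.
by rewrite !mxdot_cofE /GRing.scale/= /F /G; ring.
Qed.

(** * The conservation law *)

(** The velocity is tangent to [SL(2)]: this is the derivative of
    [2 det A = <cof A, A> = 2]. *)
Lemma mxdot_cof_velocity {R : realType} {A : R -> 'M[R]_2} {t : R} {dA} :
  (forall s : R, \det (A s) = 1) -> is_derive t 1 A dA -> mxdot (cof (A t)) dA = 0.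
Proof.
move=> A1 Ad; have := is_derive_mxdot_cof Ad Ad.
have -> : (fun s => mxdot (cof (A s)) (A s)) = cst 2.
  by apply/funext => s; rewrite mxdot_cof_det A1 mulr1.
move=> /@derive_val; rewrite derive_cst mxdot_cofC -mulr2n => /esym/eqP.
by rewrite mulrn_eq0 /= => /eqP.
Qed.

(** The pressure coefficient in terms of position and velocity, from the second
    derivative of the constraint [det A = 1].  Here and below, [A1] and [A2] are
    the first and second derivatives of [A]. *)
Lemma affine_pressure_eq {R : realType} {kappa : R} {A : R -> 'M[R]_2}
    {lambda : R -> R} {A1 A2 : R -> 'M[R]_2} :
  (forall s : R, \det (A s) = 1) ->
  (forall s : R, is_derive s 1 A (A1 s)) ->
  (forall s : R, is_derive s 1 A1 (A2 s)) ->
  (forall s : R, A2 s + kappa *: A s = lambda s *: cof (A s)) ->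
  forall t,
  lambda t * mxdot (A t) (A t) = 2 * kappa - mxdot (cof (A1 t)) (A1 t).
Proof.
move=> detA Ad A1d ode t.
have := is_derive_mxdot_cof (Ad t) (A1d t).
have -> : (fun s => mxdot (cof (A s)) (A1 s)) = cst 0.
  by apply/funext => s; exact: mxdot_cof_velocity.
move=> /@derive_val; rewrite derive_cst (canRL (addrK _) (ode t)).
rewrite mxdotBr !mxdotZr mxdot_cof_cof (mxdot_cof_det (A t)) detA.
lra.
Qed.

(** In the proof, [q = <cof A', A'>] and [r = |A|^2], so that the conserved
    quantity is [(2 kappa - q) r = lambda r^2]. *)
Lemma lambda_norm_conserved {R : realType} {kappa : R} {A : R -> 'M[R]_2}
    {lambda : R -> R} {A1 A2 : R -> 'M[R]_2} :
  (forall s : R, \det (A s) = 1) ->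
  (forall s : R, is_derive s 1 A (A1 s)) ->
  (forall s : R, is_derive s 1 A1 (A2 s)) ->
  (forall s : R, A2 s + kappa *: A s = lambda s *: cof (A s)) ->
  forall s t, lambda s * mxdot (A s) (A s) ^+ 2 =
              lambda t * mxdot (A t) (A t) ^+ 2.
Proof.
move=> detA Ad A1d ode s t.
pose q s := mxdot (cof (A1 s)) (A1 s); pose r s := mxdot (A s) (A s).
have qE x : lambda x * r x = 2 * kappa - q x.
  exact: affine_pressure_eq.
suff : ((cst (2 * kappa) - q) * r) s = ((cst (2 * kappa) - q) * r) t.
  by rewrite !fctE -!qE !expr2 !mulrA.
apply: is_derive_0_is_cst => x.
have qd : is_derive x 1 q (2 * mxdot (cof (A1 x)) (A2 x)).
  apply: is_derive_eq (is_derive_mxdot_cof (A1d x) (A1d x)) _.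
  by rewrite mxdot_cofC; ring.
have rd : is_derive x 1 r (2 * mxdot (A x) (A1 x)).
  apply: is_derive_eq (is_derive_mxdot (Ad x) (Ad x)) _.
  by rewrite mxdotC; ring.
apply: is_derive_eq; rewrite !fctE -qE /GRing.scale /=.
rewrite (canRL (addrK _) (ode x)) mxdotBr !mxdotZr mxdot_cof_cof.
rewrite (mxdot_cofC (A1 x)) (mxdot_cof_velocity detA)// (mxdotC (A1 x)).
ring.
Qed.

Lemma sg_lambda_const {R : realType} {kappa : R} {A : R -> 'M[R]_2}
    {lambda : R -> R} {A1 A2 : R -> 'M[R]_2} :
  (forall s : R, \det (A s) = 1) ->
  (forall s : R, is_derive s 1 A (A1 s)) ->
  (forall s : R, is_derive s 1 A1 (A2 s)) ->
  (forall s : R, A2 s + kappa *: A s = lambda s *: cof (A s)) ->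
  forall s t, Num.sg (lambda s) = Num.sg (lambda t).
Proof.
move=> detA Ad A1d ode s t.
have r_gt0 x : 0 < mxdot (A x) (A x) ^+ 2.
  rewrite exprn_gt0// mxdot_gt0//; apply/eqP => A0.
  by have := detA x; rewrite A0 det2E !mxE; lra.
have := congr1 Num.sg (lambda_norm_conserved detA Ad A1d ode s t).
by rewrite !(sgrM (lambda _)) !(gtr0_sg (r_gt0 _)) !mulr1.
Qed.

(** * The interior of the fluid domain *)

Lemma enorm_sqr {R : realType} (v : 'cV[R]_2) :
  enorm v ^+ 2 = v 0 0 ^+ 2 + v 1 0 ^+ 2.
Proof. by rewrite sqr_sqrtr sum_ord2// addr_ge0// sqr_ge0. Qed.

Lemma enormZ {R : realType} (a : R) (v : 'cV[R]_2) :
  enorm (a *: v) = `|a| * enorm v.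
Proof.
apply/eqP; rewrite -(@eqrXn2 _ 2) ?mulr_ge0 ?sqrtr_ge0//.
by rewrite exprMn !enorm_sqr !mxE real_normK ?num_real//; apply/eqP; ring.
Qed.

Lemma enorm0 {R : realType} : enorm (0 : 'cV[R]_2) = 0.
Proof. by rewrite -(scale0r 0) enormZ normr0 mul0r. Qed.

Lemma enorm_sqr_mulmx_continuous {R : realType} (B : 'M[R]_2) :
  continuous (fun x : 'cV[R]_2 => enorm (B *m x) ^+ 2).
Proof.
pose Bx i (x : 'cV[R]_2) := (B *m x) i 0.
have -> : (fun x : 'cV[R]_2 => enorm (B *m x) ^+ 2) =
    (Bx 0 \* Bx 0) \+ (Bx 1 \* Bx 1).
  by apply/funext => x; rewrite enorm_sqr !expr2.
have Bx_cont i : continuous (Bx i).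
  pose x_ j (x : 'cV[R]_2) := x j 0.
  have -> : Bx i = (cst (B i 0) \* x_ 0) \+ (cst (B i 1) \* x_ 1).
    by apply/funext => x; rewrite /Bx mxE sum_ord2.
  have x_cont j x : {for x, continuous (x_ j)} by exact: coord_continuous.
  move=> x; apply: continuousD; apply: continuousM (x_cont _ x);
    exact: cst_continuous.
by move=> x; apply: continuousD; apply: continuousM; exact: Bx_cont.
Qed.

Lemma fluid_domainE {R : realType} (A : R -> 'M[R]_2) (t : R) :
  A t \in unitmx -> fluid_domain A t = [set x | enorm (invmx (A t) *m x) <= 1].
Proof.
move=> Au; apply/seteqP; split => [_ [y y1 <-]|x x1] /=; first by rewrite mulKmx.
by exists (invmx (A t) *m x); rewrite ?mulKVmx.
Qed.

Lemma interior_fluid_domainE {R : realType} (A : R -> 'M[R]_2) (t : R) :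
  A t \in unitmx ->
  (fluid_domain A t)° = [set x | enorm (invmx (A t) *m x) < 1].
Proof.
move=> Au; rewrite fluid_domainE//; apply/seteqP; split => x /= xD.
  (* If x is interior, s x lies in the domain for some s > 1; then
     s |A^-1 x| <= 1 forces |A^-1 x| < 1. *)
  have scale_cvg : s *: x @[s --> (1 : R)^'+] --> x.
    rewrite -[X in _ --> X]scale1r.
    by apply: cvg_at_right_filter; apply: cvgZr_tmp; exact: cvg_id.
  have [s [s1 /=]] := filter_ex (filterI (nbhs_right_gt 1) (scale_cvg _ xD)).
  rewrite -scalemxAr enormZ gtr0_norm ?(lt_trans _ s1)//.
  apply: contraTT; rewrite -leNgt -ltNge => x1; apply: (lt_le_trans s1).
  by rewrite ler_peMr// ltW// (lt_trans _ s1).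
have : \forall y \near x, enorm (invmx (A t) *m y) ^+ 2 < 1.
  have := enorm_sqr_mulmx_continuous (invmx (A t)) x.
  move=> /cvgr_lt; apply.
  by rewrite expr_lt1// sqrtr_ge0.
apply: filterS => y; rewrite expr_lt1 ?sqrtr_ge0//; exact: ltW.
Qed.

(** * Preservation of the sign of the pressure *)

Theorem corollary9p3 (R : realType) (c0 kappa : R) (A : R -> 'M[R]_2)
    (lambda : R -> R)
    (hkappa : kappa = c0 ^+ 2)
    (A_C0 : continuous A)
    (A_SL2 : forall t : R, SL2 (A t))
    (A_C2 : C2 A)
    (lambda_C0 : continuous lambda)
    (A_ode : forall t : R,
       A^`(2)%classic t + kappa *: A t = lambda t *: cof (A t)) :
  (forall t sigma : R,
     has_sign_on (interior (fluid_domain A t)) (pressure A lambda t) sigma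
     <-> Num.sg (lambda t) = sigma) /\
  (exists sigma : R, forall t : R,
     has_sign_on (interior (fluid_domain A t)) (pressure A lambda t) sigma).
Proof.
have Au t : A t \in unitmx by rewrite unitmxE A_SL2 unitr1.
have sign_iff t sigma :
    has_sign_on (interior (fluid_domain A t)) (pressure A lambda t) sigma
    <-> Num.sg (lambda t) = sigma.
  split => [sgp|sgl x].
    (* The pressure at the origin is [lambda t / 2]. *)
    rewrite -(sgp 0).
      rewrite /pressure mulmx0 enorm0 expr0n/= subr0 mulr1.
      by rewrite sgrM (@gtr0_sg _ 2^-1)// mul1r.
    by rewrite interior_fluid_domainE//= mulmx0 enorm0 ltr01.
  rewrite interior_fluid_domainE//= => x1.
  rewrite /pressure !sgrM (@gtr0_sg _ 2^-1)// mul1r sgl gtr0_sg ?mulr1//.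
  by rewrite subr_gt0 expr_lt1// sqrtr_ge0.
split=> //; exists (Num.sg (lambda 0)) => t; apply/sign_iff.
have [dA ddA _] := A_C2.
have is_d (f : R -> 'M[R]_2) s : derivable f s 1 -> is_derive s 1 f (f^`() s).
  by move=> fd; rewrite derive1E; exact: DeriveDef.
have detA s : \det (A s) = 1 by exact: A_SL2.
have Ad (s : R) : is_derive s 1 A (A^`() s) by exact: is_d.
have A'd (s : R) : is_derive s 1 A^`() (A^`()^`() s) by exact: is_d.
exact: (sg_lambda_const detA Ad A'd A_ode).
Qed.
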